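(* Let $n=3$, $0<\gamma<n$, $1<p\le q<\infty$, and let $\alpha,\beta$ be real numbers with $\alpha<\frac{n}{p'}$, $\beta<\frac nq$ and $\frac1q=\frac1p+\frac{\gamma+\alpha+\beta}{n}-1$. If $$\alpha+\beta<(n-1)\left(\frac1q-\frac1p\right),$$ then there exists a radially symmetric function $f_0$ on $\mathbb{R}^n$ such that $|x|^\alpha f_0\in L^p(\mathbb{R}^n)$ but $|x|^{-\beta}T_\gamma f_0\notin L^q(\mathbb{R}^n)$. In other words, for $n=3$ the condition $\alpha+\beta\ge (n-1)\left(\frac1q-\frac1p\right)$ is necessary for the inequality $$\big\||x|^{-\beta}T_\gamma v\big\|_{L^q(\mathbb{R}^n)}\le C\,\big\||x|^{\alpha}v\big\|_{L^p(\mathbb{R}^n)}$$ to hold, with $C$ independent of $v$, for all radially symmetric $v\in L^p(\mathbb{R}^n,|x|^{p\alpha}dx)$.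
   Context: For $0<\gamma<n$, the fractional integral operator is $$(T_\gamma v)(x)=\int_{\mathbb{R}^n}\frac{v(y)}{|x-y|^\gamma}\,dy .$$ Here $p'$ denotes the conjugate exponent of $p$, i.e. $\frac1p+\frac1{p'}=1$. A function on $\mathbb{R}^n$ is radially symmetric if it depends only on $|x|$. The space $L^p(\mathbb{R}^n,|x|^{p\alpha}dx)$ consists of the measurable $v$ with $|x|^\alpha v\in L^p(\mathbb{R}^n)$. *)

(* Defs.v *)
From HB Require Import structures.
From mathcomp Require Export all_boot all_order all_algebra.
From mathcomp Require Export all_classical all_reals all_analysis measurable_realfun.

Set Implicit Arguments.
Unset Strict Implicit.
Unset Printing Implicit Defensive.

Import Order.TTheory GRing.Theory Num.Theory.
Import numFieldNormedType.Exports.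

Local Open Scope classical_set_scope.
Local Open Scope ring_scope.

Notation R3 R := (measurableTypeR R * measurableTypeR R * measurableTypeR R)%type.

Definition leb3 {R : realType} : set (R3 R) -> \bar R :=
  ((lebesgue_measure \x lebesgue_measure) \x lebesgue_measure)%E.

HB.instance Definition _ (R : realType) := Measure.on (@leb3 R).

(* The norm that the library puts on a product type is the sup norm. *)
Definition enorm {R : realType} (x : R3 R) : R :=
  Num.sqrt (x.1.1 ^+ 2 + x.1.2 ^+ 2 + x.2 ^+ 2).

Definition radial {R : realType} (f : R3 R -> R) : Prop :=
  forall x y, enorm x = enorm y -> f x = f y.

(* Extended-real valued.  Since [0 `^ g = 0] for [g != 0] and [0^-1 = 0], the
   integrand is set to 0 on the null set [y = x]. *)
Definition fracint {R : realType} (g : R) (v : R3 R -> R) (x : R3 R) : \bar R :=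
  (\int[leb3]_y (v y / enorm (x - y) `^ g)%:E)%E.

(* [|x|^a h]; at the origin the weight is 0 when [a != 0]. *)
Definition weighted {R : realType} (a : R) (h : R3 R -> \bar R)
    (x : R3 R) : \bar R :=
  ((enorm x `^ a)%:E * h x)%E.

(* Counterpart of [Lfun] for extended-real valued functions. *)
Definition inLp {R : realType} (p : R) (h : R3 R -> \bar R) : Prop :=
  measurable_fun setT h /\ ('N[leb3]_(p%:E)[h] < +oo)%E.

Definition inLp_weighted {R : realType} (p a : R) (v : R3 R -> R) : Prop :=
  measurable_fun setT v /\ inLp p (weighted a (EFin \o v)).

(* Main.v *)
Require Import Defs.
From mathcomp Require Import ring lra.

Set Implicit Arguments.
Unset Strict Implicit.
Unset Printing Implicit Defensive.

Import Order.TTheory GRing.Theory Num.Theory.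
Import numFieldNormedType.Exports.
Local Open Scope classical_set_scope.
Local Open Scope ring_scope.

(** The scaling relation turns [alpha + beta < 2 (1/q - 1/p)] into
    [3 - gamma < 1/p - 1/q].  Let [S] be a shell [r <= |x| < r + h] with
    [1 <= r] and [r + h <= 2].  Each [x] in [S] has a box of side comparable to
    [h] inside [S] and within distance [h] of [x], whence
    [T_gamma 1_S >= c h^(3 - gamma)] on [S].  If moreover [|S| <= K h], then
    [|| T_gamma 1_S ||_q / || 1_S ||_p >= c h^(3 - gamma) |S|^(1/q - 1/p)]
    blows up as [h -> 0].  A shell with [|S| <= K h] is found by pigeonhole in
    any annulus cut into equally thick shells.  The function [f0] is a suitably
    weighted sum of indicators of such shells, one in each of the disjoint
    annuli [1 + 1/(k+2) <= |x| < 1 + 1/(k+1)], where the weights [|x|^alpha] and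
    [|x|^-beta] are harmless. *)

(** * The Euclidean norm on R^3 *)

Lemma sqrt_sum3_triangle {R : rcfType} (a b c u v w : R) :
  Num.sqrt ((a + u) ^+ 2 + (b + v) ^+ 2 + (c + w) ^+ 2) <=
  Num.sqrt (a ^+ 2 + b ^+ 2 + c ^+ 2) + Num.sqrt (u ^+ 2 + v ^+ 2 + w ^+ 2).
Proof.
have S0 (i j k : R) : 0 <= i ^+ 2 + j ^+ 2 + k ^+ 2.
  by rewrite !addr_ge0// sqr_ge0.
have sqE (i j k : R) := sqr_sqrtr (S0 i j k).
rewrite -(@ler_pXn2r _ 2)// ?nnegrE ?addr_ge0 ?sqrtr_ge0//.
rewrite [leRHS]sqrrD !sqE.
have : a * u + b * v + c * w <=
    Num.sqrt (a ^+ 2 + b ^+ 2 + c ^+ 2) * Num.sqrt (u ^+ 2 + v ^+ 2 + w ^+ 2).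
  apply: le_trans (ler_norm _) _.
  rewrite -(@ler_pXn2r _ 2)// ?nnegrE ?mulr_ge0 ?sqrtr_ge0//.
  rewrite real_normK ?num_real// exprMn !sqE.
  (* Lagrange's identity: the gap in Cauchy-Schwarz is the squared length of the cross product. *)
  rewrite -subr_ge0 [leRHS](_ : _ = (a * v - b * u) ^+ 2 +
    (a * w - c * u) ^+ 2 + (b * w - c * v) ^+ 2) ?S0//.
  by ring.
by rewrite -mulr_natl; lra.
Qed.

Section enorm.
Context {R : realType}.
Implicit Types x y : R3 R.

Lemma enormB x y : enorm (x - y) = enorm (y - x).
Proof. by rewrite /enorm; congr Num.sqrt => /=; ring. Qed.

Lemma enormD x y : enorm (x + y) <= enorm x + enorm y.
Proof. exact: sqrt_sum3_triangle. Qed.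

Lemma enormZ (s a b c : R) :
  enorm (s * a, s * b, s * c) = `|s| * enorm (a, b, c).
Proof.
by rewrite /enorm /= !exprMn -!mulrDr sqrtrM ?sqr_ge0// sqrtr_sqr.
Qed.

Lemma measurable_enorm : measurable_fun setT (@enorm R).
Proof.
have mX (f : R3 R -> measurableTypeR R) : measurable_fun setT f ->
  measurable_fun setT (fun x => f x ^+ 2 : measurableTypeR R).
  exact: measurable_funX.
apply: (@measurableT_comp _ _ _ _ _ _ (@Num.sqrt R)).
  exact: (@continuous_measurable_fun R _ (@sqrt_continuous R)).
apply: measurable_funD; [apply: measurable_funD|]; apply: mX.
- exact: (measurableT_comp measurable_fst measurable_fst).
- exact: (measurableT_comp measurable_snd measurable_fst).
- exact: measurable_snd.
Qed.

Lemma coord_le_enorm x :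
  [/\ `|x.1.1| <= enorm x, `|x.1.2| <= enorm x & `|x.2| <= enorm x].
Proof.
rewrite -!sqrtr_sqr /enorm; split; apply: ler_wsqrtr.
- by rewrite -addrA lerDl addr_ge0// sqr_ge0.
- by rewrite addrAC lerDr addr_ge0// sqr_ge0.
- by rewrite lerDr addr_ge0// sqr_ge0.
Qed.

(** The strict bound comes from [sqrt 3 < 2]. *)
Lemma enorm_lt_double (e a b c : R) : 0 < e ->
  `|a| <= e -> `|b| <= e -> `|c| <= e -> enorm (a, b, c) < 2 * e.
Proof.
move=> e0 ae be ce; have e2 : 0 <= 2 * e by lra.
rewrite -[ltRHS]ger0_norm// -sqrtr_sqr /enorm /=.
have sq (u : R) : `|u| <= e -> u ^+ 2 <= e ^+ 2.
  by move=> ue; rewrite -(real_normK (num_real u)) lerXn2r ?nnegrE// ltW.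
rewrite ltr_sqrt; last by rewrite exprn_gt0//; lra.
have := sq _ ae; have := sq _ be; have := sq _ ce.
have : 0 < e ^+ 2 by rewrite exprn_gt0.
rewrite exprMn; lra.
Qed.

End enorm.

(** * Lower bounds for integrals of nonnegative functions *)

Section integral_lower_bound.
Context d (T : measurableType d) (R : realType).
Context (mu : {measure set T -> \bar R}).
Local Open Scope ereal_scope.

(* The integral of a nonnegative function is a supremum over simple functions
   below it, so no measurability is needed here. *)
Lemma le_integral_ge0 (f g : T -> \bar R) :
  (forall x, 0 <= f x) -> (forall x, f x <= g x) ->
  \int[mu]_x f x <= \int[mu]_x g x.
Proof.
move=> f0 fg; have g0 x : 0 <= g x by exact: le_trans (fg x).
rewrite !ge0_integralE//; apply: ereal_sup_le => _ [h hf <-].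
exists h => // x; apply: le_trans (hf x) _.
by rewrite /patch; case: ifP.
Qed.

Lemma mul_measure_le_integral (A : set T) (c : R) (f : T -> \bar R) :
  measurable A -> (0 <= c)%R -> (forall x, 0 <= f x) ->
  (forall x, A x -> c%:E <= f x) -> c%:E * mu A <= \int[mu]_x f x.
Proof.
move=> mA c0 f0 cf; rewrite -integral_cst// integral_mkcond.
apply: le_integral_ge0 => x; rewrite /patch; case: ifPn => //=.
by rewrite inE => /cf.
Qed.

End integral_lower_bound.

(** * Thin spherical shells and the size of the fractional integral on them *)

Section shell.
Context {R : realType}.
Implicit Types x y : R3 R.

(** Half-open in the radius, so that adjacent shells are disjoint. *)
Definition shell (r h : R) : set (R3 R) := [set x | r <= enorm x < r + h].

Lemma measurable_shell (r h : R) : measurable (shell r h).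
Proof.
have -> : shell r h = setT `&` @enorm R @^-1` [set` `[r, r + h[].
  by rewrite setTI; apply/seteqP; split => x /=; rewrite in_itv.
by apply: measurable_enorm => //; exact: measurable_itv.
Qed.

Lemma leb3_box (I J K : interval R) :
  measurable ([set` I] `*` [set` J] `*` [set` K] : set (R3 R)) /\
  leb3 ([set` I] `*` [set` J] `*` [set` K] : set (R3 R)) =
  (lebesgue_measure [set` I] * lebesgue_measure [set` J] *
   lebesgue_measure [set` K])%E.
Proof.
have mI (L : interval R) : measurable ([set` L] : set (measurableTypeR R)).
  exact: measurable_itv.
have mIJ : measurable
    ([set` I] `*` [set` J] : set (measurableTypeR R * measurableTypeR R)).
  exact: measurableX.
split; first exact: measurableX.
by rewrite /leb3 product_measure1E//= product_measure1E.
Qed.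

(* [Q] avoids [x] because the integrand of [fracint] has the junk value 0 at
   [y = x]. *)
Lemma shell_box (r h : R) x : 0 < r -> 0 < h -> shell r h x ->
  exists Q : set (R3 R), [/\ measurable Q, leb3 Q = (h ^+ 3 / 16)%:E,
    Q `<=` shell r h & forall y, Q y -> 0 < enorm (x - y) <= h].
Proof.
move=> r0 h0; case: x => [[a b] c] /andP[rx xrh].
set x := (a, b, c) in rx xrh *.
have x0 : 0 < enorm x by exact: lt_le_trans rx.
(* Scaling by [s] moves [x] along its ray to the point [z] at mid-radius, so [|x - z|] is the
   distance from [|x|] to [r + h/2], at most [h/2]. *)
pose s := (r + h / 2) / enorm x.
have s0 : 0 < s by rewrite divr_gt0//; lra.
have sx : s * enorm x = r + h / 2 by rewrite /s divfK// gt_eqF.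
pose z : R3 R := (s * a, s * b, s * c).
have Ez : enorm z = r + h / 2 by rewrite /z enormZ gtr0_norm.
have Exz : enorm (x - z) <= h / 2.
  have -> : x - z = ((1 - s) * a, (1 - s) * b, (1 - s) * c) :> R3 R.
    by congr (_, _, _) => /=; ring.
  rewrite enormZ -[enorm _]gtr0_norm// -normrM mulrBl mul1r sx ler_norml.
  by apply/andP; split; lra.
(* The third side starts at [s * c] and extends away from [c], so the open box misses the plane of
   points with last coordinate [c]. Its sides are [h/2], [h/2] and [h/4], whence the volume
   [h^3 / 16]. *)
have [t [tl tr tx]] : exists t : R, [/\ s * c - h / 4 <= t, t <= s * c &
    forall w : R, t < w < t + h / 4 -> w != c].
  move: (c : R) => e; have [cs|cs] := leP e (s * e).
    exists (s * e); split => // [|w /andP[w1 w2]]; first by lra.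
    by rewrite gt_eqF//; lra.
  exists (s * e - h / 4); split => // [|w /andP[w1 w2]]; first by lra.
  by rewrite lt_eqF//; lra.
exists ((`]s * a - h / 4, s * a + h / 4[ `*` `]s * b - h / 4, s * b + h / 4[)
   `*` `]t, t + h / 4[).
have [mQ lQ] := leb3_box `]s * a - h / 4, s * a + h / 4[
  `]s * b - h / 4, s * b + h / 4[ `]t, t + h / 4[.
(* Points of the box lie within [h/2] of [z]. This keeps them in the shell and, since
   [|x - z| <= h/2], within [h] of [x]. *)
have nearQ (u v w : R) : s * a - h / 4 < u < s * a + h / 4 ->
    s * b - h / 4 < v < s * b + h / 4 -> t < w < t + h / 4 ->
    enorm ((u, v, w) - z) < h / 2.
  move=> /andP[u1 u2] /andP[v1 v2] /andP[w1 w2].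
  rewrite [ltRHS](_ : _ = 2 * (h / 4)); last by field.
  apply: enorm_lt_double => /=; first by lra.
  - by rewrite ler_norml; apply/andP; split; lra.
  - by rewrite ler_norml; apply/andP; split; lra.
  - by rewrite ler_norml; apply/andP; split; lra.
split => //.
- rewrite lQ !lebesgue_measure_itv /= !lte_fin !ifT; [|lra..].
  by rewrite -!EFinB -!EFinM; congr EFin; field.
- move=> [[u v] w] [[/=]]; rewrite !in_itv /= => Iu Iv Iw.
  have := nearQ _ _ _ Iu Iv Iw.
  have := enormD ((u, v, w) - z) z; have := enormD (z - (u, v, w)) (u, v, w).
  rewrite !subrK Ez (enormB z) /shell /= => ? ? ?; lra.
- move=> [[u v] w] [[/=]]; rewrite !in_itv /= => Iu Iv Iw.
  have [_ _] := coord_le_enorm (x - (u, v, w)) => /= wc.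
  apply/andP; split.
    by apply: lt_le_trans wc; rewrite normr_gt0 subr_eq0 eq_sym; exact: tx.
  have := nearQ _ _ _ Iu Iv Iw.
  have := enormD (x - z) (z - (u, v, w)).
  rewrite addrA subrK (enormB z) => ? ?; lra.
Qed.

(* Pigeonhole over equally thick shells replaces the computation of the
   volume of a shell in polar coordinates; the cube [-2, 2]^3 has volume 64,
   and 65 leaves the strict inequality that the contradiction needs. *)
Lemma thin_shell (a b : R) (N : nat) : 0 <= a -> a < b -> b <= 2 -> (0 < N)%N ->
  exists r : R, [/\ a <= r, r + (b - a) / N%:R <= b &
    (leb3 (shell r ((b - a) / N%:R)) <= (65 / N%:R)%:E)%E].
Proof.
move=> a0 ab b2 N0; set h := (b - a) / N%:R.
have N0' : 0 < N%:R :> R by rewrite ltr0n.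
have h0 : 0 < h by rewrite divr_gt0// subr_gt0.
have hN : h * N%:R = b - a by rewrite divfK// gt_eqF.
pose F (j : nat) := shell (a + j%:R * h) h.
have stepF (i j : nat) : (i < j)%N -> a + i%:R * h + h <= a + j%:R * h.
  move=> ij; rewrite -addrA lerD2l -{2}[h]mul1r -mulrDl natr1.
  by rewrite ler_wpM2r ?ler_nat// ltW.
apply: contrapT => /forallNP noshell.
have bigF (j : 'I_N) : ((65 / N%:R)%:E <= leb3 (F j))%E.
  have [//|small] := leP (65 / N%:R)%:E (leb3 (F j)).
  case: (noshell (a + j%:R * h)); split; last exact: ltW.
    by rewrite lerDl mulr_ge0// ltW.
  have /stepF : (j < N)%N by [].
  by rewrite [N%:R * h]mulrC hN; lra.
have trivF : trivIset setT F.
  apply: ltn_trivIset => i j ij; apply/seteqP; split => // x [].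
  move=> /andP[_ xi] /andP[xj _]; have := stepF _ _ ij; lra.
have := @measure_bigsetU _ _ _ (@leb3 R) F (fun=> measurable_shell _ _) trivF N.
have : (leb3 (\big[setU/set0]_(i < N) F i) <= 64%:E)%E.
  have [mQ lQ] := leb3_box `[-2, 2] `[-2, 2] `[-2, 2].
  pose I2 : set (measurableTypeR R) := [set` `[-2, 2]].
  rewrite [leRHS](_ : _ = leb3 (I2 `*` I2 `*` I2)); last first.
    rewrite lQ !lebesgue_measure_itv /= !lte_fin !ifT; [|lra..].
    by rewrite -!EFinB -!EFinM; congr EFin; ring.
  apply: le_measure; rewrite ?inE//.
    by apply: bigsetU_measurable => i _; exact: measurable_shell.
  rewrite -bigcup_mkord => x [i /= iN] /andP[_ xi].
  have xb := lt_le_trans xi (stepF _ _ iN).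
  have [x1 x2 x3] := coord_le_enorm x.
  have {}xb : enorm x <= 2 by move: xb; rewrite [N%:R * h]mulrC hN; lra.
  split => /=; [split => /=|]; rewrite /I2 /= in_itv /= -ler_norml.
  - exact: le_trans xb.
  - exact: le_trans xb.
  - exact: le_trans xb.
move=> /[swap] ->; apply/negP; rewrite -ltNge.
apply: (@lt_le_trans _ _ (\sum_(i < N) (65 / N%:R)%:E)%E); last first.
  by apply: lee_sum => i _; exact: bigF.
rewrite sumEFin sumr_const card_ord -[_ *+ N]mulr_natr divfK ?gt_eqF//.
by rewrite lte_fin; lra.
Qed.

(** On the box given by [shell_box] the integrand is at least [l / h^g], and the box has volume
    [h^3 / 16]. *)
Lemma fracint_shell_ge (g l r h : R) (v : R3 R -> R) x :
  0 <= g -> 0 < r -> 0 < h -> 0 <= l -> (forall y, 0 <= v y) ->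
  (forall y, shell r h y -> l <= v y) -> shell r h x ->
  ((l * h `^ (3 - g) / 16)%:E <= fracint g v x)%E.
Proof.
move=> g0 r0 h0 l0 v0 lv /(shell_box r0 h0)[Q [mQ lQ Qs Qx]].
have -> : ((l * h `^ (3 - g) / 16)%:E = (l / h `^ g)%:E * leb3 Q)%E.
  have -> : h `^ (3 - g) = h ^+ 3 / h `^ g.
    by rewrite powRD ?(gt_eqF h0) ?implybT// powRN (powR_mulrn 3 (ltW h0)).
  by rewrite lQ -EFinM; congr EFin; ring.
apply: mul_measure_le_integral => //.
- by rewrite divr_ge0 ?powR_ge0.
- by move=> y; rewrite lee_fin divr_ge0 ?powR_ge0.
- move=> y Qy; have /andP[xy0 xyh] := Qx y Qy.
  rewrite lee_fin ler_pM ?invr_ge0 ?powR_ge0//; first exact/lv/Qs.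
  by rewrite lef_pV2 ?posrE ?powR_gt0// ge0_ler_powR ?nnegrE// ltW.
Qed.

End shell.

(** * Blow-up on a single thin shell *)

Lemma ler_powR_le0 {R : realType} (s x y : R) :
  s <= 0 -> 0 < x -> x <= y -> y `^ s <= x `^ s.
Proof.
move=> s0 x0 xy; have y0 : 0 < y by exact: lt_le_trans xy.
rewrite -[s]opprK (powRN y) (powRN x) lef_pV2 ?posrE ?powR_gt0//.
by rewrite ge0_ler_powR ?nnegrE ?oppr_ge0// ltW.
Qed.

(** Here [V] stands for the volume of a shell and [(M V)^(-1/p)] for the height whose p-th power
    integrates to [1/M] over it. The right side is a constant times [V^(1 - s) h^(q (3 - g))] with
    [s = q/p >= 1], so [V <= K h] bounds it below by [D h^(-th)] with [th > 0]. *)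
Lemma thin_shell_gain {R : realType} (g p q K M B : R) :
  0 < p -> p <= q -> 3 - g < p^-1 - q^-1 -> 0 < K -> 0 < M -> 0 < B ->
  exists2 d : R, 0 < d &
    forall h V : R, 0 < h -> h <= d -> 0 < V -> V <= K * h ->
    M <= (B * ((M * V)^-1 `^ p^-1 * h `^ (3 - g) / 16)) `^ q * V.
Proof.
move=> p0 pq gpq K0 M0 B0; have q0 : 0 < q by exact: lt_le_trans pq.
pose s := q / p; pose th := s - 1 - q * (3 - g).
have s1 : 1 <= s by rewrite /s ler_pdivlMr// mul1r.
have th0 : 0 < th.
  have -> : th = q * (p^-1 - q^-1 - (3 - g)).
    by rewrite /th /s; field; rewrite !gt_eqF.
  by rewrite mulr_gt0// subr_gt0.
pose D := (B / 16) `^ q * M `^ (- s) * K `^ (1 - s).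
have D0 : 0 < D by rewrite !mulr_gt0 ?powR_gt0 ?divr_gt0.
(* This [d] solves [D d^(-th) = M]. *)
exists ((D / M) `^ th^-1); first by rewrite powR_gt0// divr_gt0.
move=> h V h0 hd V0 VK.
have hne : h != 0 by rewrite gt_eqF.
have hth : h `^ th <= D / M.
  have := ge0_ler_powR (ltW th0) (ltW h0) (powR_ge0 _ _) hd.
  by rewrite -powRrM mulVf ?gt_eqF// powRr1// ltW// divr_gt0.
have MV0 : 0 < M * V by rewrite mulr_gt0.
have -> : B * ((M * V)^-1 `^ p^-1 * h `^ (3 - g) / 16) =
    B / 16 * ((M * V) `^ (- p^-1) * h `^ (3 - g)).
  rewrite -[(M * V)^-1](powR_inv1 (ltW MV0)) -powRrM mulN1r; ring.
have B16 : 0 <= B / 16 by rewrite divr_ge0// ltW.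
rewrite powRM//; last by rewrite mulr_ge0 ?powR_ge0.
rewrite (powRM _ (powR_ge0 _ _) (powR_ge0 _ _)) -!powRrM.
have -> : - p^-1 * q = - s by rewrite /s; ring.
rewrite (powRM _ (ltW M0) (ltW V0)).
have -> : (B / 16) `^ q * (M `^ (- s) * V `^ (- s) * h `^ ((3 - g) * q)) * V =
    (B / 16) `^ q * M `^ (- s) * V `^ (1 - s) * h `^ ((3 - g) * q).
  rewrite powRD ?(gt_eqF V0) ?implybT// powRr1 ?ltW//; ring.
have VKh : K `^ (1 - s) * h `^ (1 - s) <= V `^ (1 - s).
  by rewrite -(powRM _ (ltW K0) (ltW h0)) ler_powR_le0// subr_le0.
have : M <= D * h `^ (- th).
  by rewrite powRN ler_pdivlMr ?powR_gt0// mulrC -ler_pdivlMr.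
move=> /le_trans; apply.
have -> : - th = (1 - s) + (3 - g) * q by rewrite /th; ring.
rewrite powRD ?hne ?implybT// mulrA ler_wpM2r ?powR_ge0// /D -!mulrA.
by rewrite !ler_wpM2l ?powR_ge0.
Qed.

(** [M] acts on both sides: as it grows, the p-th power integral of the height becomes small, while
    the q-th power integral of the lower bound for [T_gamma] becomes large. [B] is reserved for the
    weight [|x|^-beta]. *)
Lemma blowup_shell {R : realType} (g p q a b M B : R) :
  0 < p -> p <= q -> 3 - g < p^-1 - q^-1 ->
  0 < a -> a < b -> b <= 2 -> 0 < M -> 0 < B ->
  exists r h l : R, [/\ 0 < h, a <= r, r + h <= b & 0 <= l] /\
    ((l `^ p)%:E * leb3 (shell r h) <= (M^-1)%:E)%E /\
    (M%:E <= ((B * (l * h `^ (3 - g) / 16)) `^ q)%:E * leb3 (shell r h))%E.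
Proof.
move=> p0 pq gpq a0 ab b2 M0 B0.
have ba0 : 0 < b - a by rewrite subr_gt0.
have K0 : 0 < 65 / (b - a) by rewrite divr_gt0.
have [d d0 gain] := thin_shell_gain p0 pq gpq K0 M0 B0.
have [N N0 hd] : exists2 N, (0 < N)%N & (b - a) / N%:R <= d.
  have bad : 0 <= (b - a) / d by rewrite divr_ge0// ltW.
  exists (Num.bound ((b - a) / d)).+1 => //.
  rewrite ler_pdivrMr ?ltr0n// mulrC -ler_pdivrMr// ltW//.
  by apply: lt_le_trans (archi_boundP bad) _; rewrite ler_nat.
have [r [ar rb]] := thin_shell (ltW a0) ab b2 N0.
have N0' : 0 < N%:R :> R by rewrite ltr0n.
set h := (b - a) / N%:R in hd rb * => Vle.
have h0 : 0 < h by rewrite divr_gt0.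
have r0 : 0 < r by exact: lt_le_trans ar.
(* A box inside the shell shows that its volume is positive, so that the height [(M V)^(-1/p)] makes
   sense. *)
have Vge : ((h ^+ 3 / 16)%:E <= leb3 (shell r h))%E.
  have rx : shell r h (r, 0, 0).
    rewrite /shell /= /enorm /= expr0n /= !addr0 sqrtr_sqr gtr0_norm//.
    by rewrite lexx ltrDl.
  have [Q [mQ <- Qs _]] := shell_box r0 h0 rx.
  by apply: le_measure; rewrite ?inE//; exact: measurable_shell.
have VE : (fine (leb3 (shell r h)))%:E = leb3 (shell r h).
  by rewrite fineK// ge0_fin_numE// (le_lt_trans Vle) ?ltry.
set V := fine (leb3 (shell r h)) in VE.
rewrite -VE !lee_fin in Vle Vge.
have V0 : 0 < V by apply: lt_le_trans Vge; rewrite divr_gt0// exprn_gt0.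
have VK : V <= 65 / (b - a) * h.
  apply: le_trans Vle _; rewrite /h le_eqVlt; apply/orP; left; apply/eqP.
  by field; rewrite (gt_eqF N0') (gt_eqF ba0).
have MV0 : 0 < M * V by rewrite mulr_gt0.
exists r, h, ((M * V)^-1 `^ p^-1); split; first by rewrite powR_ge0.
rewrite -VE -!EFinM !lee_fin; split; last exact: gain.
rewrite -powRrM mulVf ?gt_eqF// powRr1 ?invr_ge0 ?(ltW MV0)//.
by rewrite invfM mulfVK// gt_eqF.
Qed.

(** * Superposition of shells from disjoint annuli *)

Lemma nneseries_one_term {R : realType} (u : nat -> \bar R) (k : nat) :
  (0 <= u k)%E -> (forall i, i != k -> u i = 0%E) ->
  (\sum_(i <oo) u i)%E = u k.
Proof.
move=> uk0 u0.
have uge0 i : (0 <= u i)%E by have [->//|/u0 ->] := eqVneq i k.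
rewrite nneseries_esumT// -(esum_set1 uk0) [RHS]esum_mkcond.
apply: eq_esum => i _; case: ifPn => //.
by rewrite notin_setE /= => /eqP/u0.
Qed.

(** Replaces the weights by positive constants on the annuli. As [e >= 1], the power is monotone in
    the exponent, which lies between [-|s|] and [|s|]; then [e <= 2] is used. *)
Lemma powR_annulus_bounds {R : realType} (s e : R) : 1 <= e -> e <= 2 ->
  2 `^ (- `|s|) <= e `^ s <= 2 `^ `|s|.
Proof.
move=> e1 e2; have e0 : 0 < e by lra.
apply/andP; split.
  apply: (@le_trans _ _ (e `^ (- `|s|))).
    by rewrite ler_powR_le0// oppr_le0.
  by apply: ler_powR => //; rewrite lerNl -normrN ler_norm.
apply: (@le_trans _ _ (e `^ `|s|)).
  by apply: ler_powR => //; exact: ler_norm.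
by rewrite ge0_ler_powR ?nnegrE// ltW.
Qed.

Lemma exists_radial_fracint_Lnorm_pinfty {R : realType} (g p q alpha beta : R) :
  0 < g -> 0 < p -> p <= q -> 3 - g < p^-1 - q^-1 ->
  exists f : R3 R -> R, [/\ radial f, inLp_weighted p alpha f &
    ('N[leb3]_(q%:E)[weighted (- beta) (fracint g f)] = +oo)%E].
Proof.
move=> g0 p0 pq gpq; have q0 : 0 < q by exact: lt_le_trans pq.
pose A : R := 2 `^ `|alpha|; pose B : R := 2 `^ (- `|beta|).
have A0 : 0 <= A by exact: powR_ge0.
have B0 : 0 < B by rewrite powR_gt0.
(* The reciprocals of [M k] are summable, while [M k] is unbounded. *)
pose M (k : nat) : R := (2 ^ (k + 1))%:R.
have M0 k : 0 < M k by rewrite ltr0n expn_gt0.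
(* Since [b (k+1) = a k], the annuli are adjacent and shrink towards the unit sphere. *)
pose a (k : nat) : R := 1 + k.+2%:R^-1.
pose b (k : nat) : R := 1 + k.+1%:R^-1.
have a1 k : 1 <= a k by rewrite lerDl invr_ge0.
have ab k : a k < b k by rewrite ltrD2l ltf_pV2 ?posrE ?ltr0n// ltr_nat.
have b2 k : b k <= 2 by rewrite -[leRHS]/(1 + 1) lerD2l invf_le1 ?ler1n ?ltr0n.
have /choice[r /choice[h /choice[l P]]] k :=
  blowup_shell p0 pq gpq (lt_le_trans ltr01 (a1 k)) (ab k) (b2 k) (M0 k) B0.
pose S k := shell (r k) (h k).
have mS k : measurable (S k) by exact: measurable_shell.
have h0 k : 0 < h k by have [[]] := P k.
have l0 k : 0 <= l k by have [[]] := P k.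
have r1 k : 1 <= r k by have [[_ + _ _] _] := P k; exact: le_trans.
have Sab k x : S k x -> a k <= enorm x < b k.
  move=> /andP[rx xrh]; have [[_ ar rb _] _] := P k.
  by rewrite (le_trans ar rx) (lt_le_trans xrh rb).
have S12 k x : S k x -> 1 <= enorm x /\ enorm x <= 2.
  move=> /Sab/andP[ax xb]; split; first exact: le_trans (a1 k) ax.
  exact: le_trans (ltW xb) (b2 k).
have disj i j x : S i x -> S j x -> i = j.
  have lt_disj k m : (k < m)%N -> S k x -> S m x -> False.
    move=> km /Sab/andP[akx _] /Sab/andP[_ xbm].
    have : b m <= a k by rewrite lerD2l lef_pV2 ?posrE ?ltr0n// ler_nat.
    by move=> bmak; have := lt_le_trans xbm (le_trans bmak akx); rewrite ltxx.
  move=> Si Sj; case: (ltngtP i j) => // /lt_disj.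
    by case/(_ Si Sj).
  by case/(_ Sj Si).
(* The coefficients stay free: [c = l] gives [f], and [c = A^p l^p] gives a majorant for the p-th
   power of the weighted [f]. *)
pose u (c : nat -> R) x : \bar R := (\sum_(k <oo) (c k * \1_(S k) x)%:E)%E.
have u_on (c : nat -> R) k x :
    (forall i, 0 <= c i) -> S k x -> u c x = (c k)%:E.
  move=> c0 Skx; rewrite /u (@nneseries_one_term _ _ k).
  - by rewrite indicE mem_set// mulr1.
  - by rewrite lee_fin mulr_ge0.
  - move=> i ik; rewrite indicE memNset ?mulr0// => /disj/(_ Skx) eik.
    by rewrite eik eqxx in ik.
have u_off c x : (forall k, ~ S k x) -> u c x = 0%E.
  by move=> nS; apply: eseries0 => i _ _; rewrite indicE memNset// mulr0.
have mu_c (c : nat -> R) : (forall i, 0 <= c i) -> measurable_fun setT (u c).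
  move=> c0; apply: (@ge0_emeasurable_sum _ _ _ _ _ xpredT).
    by move=> k x _ _; rewrite lee_fin mulr_ge0.
  by move=> k _; apply/measurable_EFinP; apply: measurable_funM.
(* At each point at most one term of the series is nonzero, so its value is finite and [fine] loses
   nothing. *)
pose f x := fine (u l x).
have f_on k x : S k x -> f x = l k by move=> Skx; rewrite /f (u_on _ k).
have f_off x : (forall k, ~ S k x) -> f x = 0 by move=> nS; rewrite /f u_off.
have f0 x : 0 <= f x.
  have [[k Skx]|/forallNP nS] := pselect (exists k, S k x).
    by rewrite (f_on k).
  by rewrite f_off.
have mf : measurable_fun setT f.
  by apply: measurableT_comp; [exact: fine_measurable|exact: mu_c].
exists f; split.
- move=> x y exy; congr fine; apply: eq_eseriesr => k _.
  congr (_ * _)%:E; rewrite !indicE; congr (_%:R).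
  by congr nat_of_bool; apply: asbool_equiv_eq; rewrite /S /shell /= exy.
- split=> //; split.
    apply: emeasurable_funM; apply/measurable_EFinP => //.
    exact: (measurableT_comp (measurable_powR alpha) measurable_enorm).
  rewrite unlock; apply: poweR_lty.
  pose c k := A `^ p * l k `^ p.
  have c0 k : 0 <= c k by rewrite mulr_ge0 ?powR_ge0.
  apply: (@le_lt_trans _ _ (\int[leb3]_x u c x)%E).
    apply: le_integral_ge0 => x; first exact: poweR_ge0.
    rewrite /weighted /= ger0_norm ?mulr_ge0 ?powR_ge0//.
    have [[k Skx]|/forallNP nS] := pselect (exists k, S k x); last first.
      by rewrite f_off// u_off// mulr0 powR0// gt_eqF.
    rewrite (f_on k)// (u_on _ k)// lee_fin /c -powRM//.
    have [x1 x2] := S12 _ _ Skx.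
    have /andP[_ xA] := powR_annulus_bounds alpha x1 x2.
    apply: ge0_ler_powR; rewrite ?nnegrE ?mulr_ge0 ?powR_ge0 ?(ltW p0)//.
    by rewrite ler_wpM2r.
  rewrite integral_nneseries//; first last.
  - by move=> k x _; rewrite lee_fin mulr_ge0.
  - by move=> k; apply/measurable_EFinP; apply: measurable_funM.
  (* The bound [l k ^ p * |S k| <= 1 / M k] leaves a geometric series. *)
  apply: (@le_lt_trans _ _ (\sum_(k <oo) ((A `^ p / (2 ^ (k + 1))%:R)%R)%:E)%E).
    apply: lee_nneseries => k _.
      by move=> _; apply: integral_ge0 => x _; rewrite lee_fin mulr_ge0.
    under eq_integral do rewrite EFinM.
    rewrite ge0_integralZl_EFin//; last first.
      exact/measurable_EFinP.
    rewrite integral_indic// setIT EFinM -muleA [leRHS]EFinM lee_pmul//.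
    + by rewrite lee_fin powR_ge0.
    + by rewrite mule_ge0// lee_fin powR_ge0.
    + by have [_ []] := P k.
  have /cvg_lim -> // := @cvg_geometric_eseries_half R (A `^ p) 0.
  exact: ltry.
- have Tq : (\int[leb3]_x `|weighted (- beta) (fracint g f) x| `^ q = +oo)%E.
    (* A single shell [S k] with [M k >= m] already contributes at least [m] to the integral. *)
    apply: eq_infty => m.
    have [k mk] : exists k, m <= M k.
      exists (Num.bound `|m|); apply: le_trans (ler_norm _) _.
      apply: le_trans (ltW (archi_boundP (normr_ge0 _))) _.
      rewrite ler_nat ltnW// (leq_trans (ltn_expl _ (ltnSn 1)))//.
      by rewrite leq_exp2l// leq_addr.
    have [_ [_ Mle]] := P k.
    apply: le_trans (le_trans _ Mle) _; first by rewrite lee_fin.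
    apply: mul_measure_le_integral => [||x|x Skx].
    + exact: mS.
    + exact: powR_ge0.
    + exact: poweR_ge0.
    have [x1 x2] := S12 _ _ Skx.
    have /andP[] := powR_annulus_bounds (- beta) x1 x2.
    rewrite normrN -/B => Bx _.
    have Tge := @fracint_shell_ge _ g (l k) (r k) (h k) f x (ltW g0)
      (lt_le_trans ltr01 (r1 k)) (h0 k) (l0 k) f0 _ Skx.
    have /Tge Tx : forall y, S k y -> l k <= f y by move=> y /f_on ->.
    have T0 : 0 <= l k * h k `^ (3 - g) / 16 by rewrite !mulr_ge0 ?powR_ge0.
    have BT : ((B * (l k * h k `^ (3 - g) / 16))%:E <=
        weighted (- beta) (fracint g f) x)%E.
      by rewrite EFinM lee_pmul// lee_fin// ltW.
    have BT0 : (0 <= (B * (l k * h k `^ (3 - g) / 16))%:E)%E.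
      by rewrite lee_fin mulr_ge0// ltW.
    rewrite -poweR_EFin gee0_abs; last exact: le_trans BT.
    apply: gt0_ler_poweR; rewrite ?(ltW q0)// in_itv /= leey andbT//.
    exact: le_trans BT.
  by rewrite unlock Tq poweRyr// gt_eqF// invr_gt0.
Qed.

(** * Necessity of the exponent condition for radial functions *)

Theorem mainTheorem3 (R : realType) (gamma p p' q alpha beta : R)
  (hgamma0 : 0 < gamma) (hgamma3 : gamma < 3)
  (hp : 1 < p) (hpq : p <= q) (hpp' : p^-1 + p'^-1 = 1)
  (halpha : alpha < 3 / p') (hbeta : beta < 3 / q)
  (hscal : q^-1 = p^-1 + (gamma + alpha + beta) / 3 - 1) :
  (alpha + beta < (3 - 1) * (q^-1 - p^-1) ->
     exists f0 : R3 R -> R,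
       [/\ radial f0,
           inLp_weighted p alpha f0 &
           ~ inLp q (weighted (- beta) (fracint gamma f0))]) /\
  ((exists C : R, forall v : R3 R -> R,
      radial v -> inLp_weighted p alpha v ->
      ('N[leb3]_(q%:E)[weighted (- beta) (fracint gamma v)]
         <= C%:E * 'N[leb3]_(p%:E)[weighted alpha (EFin \o v)])%E) ->
   (3 - 1) * (q^-1 - p^-1) <= alpha + beta).
Proof.
have main : alpha + beta < (3 - 1) * (q^-1 - p^-1) ->
    exists f : R3 R -> R, [/\ radial f, inLp_weighted p alpha f &
      ('N[leb3]_(q%:E)[weighted (- beta) (fracint gamma f)] = +oo)%E].
  by move=> lt_ab; apply: exists_radial_fracint_Lnorm_pinfty => //; lra.
split=> [/main[f [rf fp Tf]]|[C bound]].
  by exists f; split => // -[_]; rewrite Tf.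
rewrite leNgt; apply/negP => /main[f [rf fp Tf]].
have [_ [_ fin]] := fp.
have fN : 'N[leb3]_(p%:E)[weighted alpha (EFin \o f)]%E \is a fin_num.
  by rewrite ge0_fin_numE ?Lnorm_ge0.
by have := bound f rf fp; rewrite Tf -(fineK fN) -EFinM leye_eq.
Qed.
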